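(* Let $\mathcal{F}$ be a periodic infinite frieze of positive integers with growth coefficients $(s_k)_{k\ge0}$. The following are equivalent: (a) There exists $k>0$ such that $s_k>2$. (b) $s_k>2$ for all $k>0$. (c) $\mathcal{F}$ does not arise from a triangulation of a punctured disc.
   Context: An infinite frieze of positive integers is an array $(m_{i,j})$, indexed by $i\in\mathbb{Z}$ and $j\ge i-2$, with $m_{i,i-2}=0$, $m_{i,i-1}=1$, with $m_{i,j}$ a positive integer for $j\ge i-1$, and with $m_{i,j}m_{i+1,j+1}-m_{i,j+1}m_{i+1,j}=1$ for all $i$ and all $j\ge i-1$. It is periodic if for some $n\ge1$ one has $m_{i+n,j+n}=m_{i,j}$ for all entries. With $n$ the minimal such period, the growth coefficients are $s_0:=2$ and $s_k:=m_{1,kn}-m_{2,kn-1}$ for $k\ge1$. The quiddity row is $a_i=m_{i,i}$; a finite block of consecutive entries whose periodic repetition is the quiddity row is called a quiddity sequence of the frieze (its length is a period, not necessarily minimal). A triangulation of a punctured disc is a maximal collection of pairwise non-crossing (non-self-crossing) arcs, up to isotopy, in the once-punctured disc with $N\ge1$ marked points on its boundary, with endpoints in the set consisting of the marked points and the puncture, none of which is contractible or isotopic to a boundary segment (loops based at boundary marked points around the puncture are allowed). It gives the sequence $(a_1,\dots,a_N)$, where $a_i$ is the number of regions incident with the boundary marked point $i$, counted in a small neighbourhood of it (i.e. one plus the number of ends of arcs at $i$), marked points being taken in cyclic order. A periodic infinite frieze of positive integers arises from a triangulation of a punctured disc if it has a quiddity sequence obtained in this way. It is known (Baur–Parsons–Tschabold)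 that every such triangulation yields a periodic infinite frieze of positive integers, that triangulations of annuli do so likewise (for each boundary component), and that every periodic infinite frieze of positive integers arises from a triangulation of a punctured disc or of an annulus. *)

(* Defs.v *)
(* Infinite friezes of positive integers and triangulations of a once-punctured
   disc (Mathematical Components). *)
From mathcomp Require Import all_boot all_order all_algebra finmap.

Set Implicit Arguments.
Unset Strict Implicit.
Unset Printing Implicit Defensive.

Import Order.TTheory GRing.Theory Num.Theory.
Local Open Scope ring_scope.

(* An array is a total function [m : int -> int -> int]; only its entries
   [m i j] with [i - 2 <= j] are meaningful, and no condition below constrains
   the others. *)
Record infinite_frieze (m : int -> int -> int) : Prop := InfiniteFrieze {
  frieze_row0 : forall i, m i (i - 2) = 0;
  frieze_row1 : forall i, m i (i - 1) = 1;
  frieze_gt0 : forall i j, i - 1 <= j -> 0 < m i j;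
  frieze_diamond : forall i j, i - 1 <= j ->
    m i j * m (i + 1) (j + 1) - m i (j + 1) * m (i + 1) j = 1
}.

Definition is_period (m : int -> int -> int) (n : nat) : Prop :=
  (0 < n)%N /\
  forall i j, i - 2 <= j -> m (i + n%:Z) (j + n%:Z) = m i j.

Definition minimal_period (m : int -> int -> int) (n : nat) : Prop :=
  is_period m n /\ forall n', is_period m n' -> (n <= n')%N.

Definition growth_coefficient (m : int -> int -> int) (n k : nat) : int :=
  if k == 0%N then 2 else m 1 (k * n)%N%:Z - m 2 ((k * n)%N%:Z - 1).

Definition quiddity (m : int -> int -> int) (i : int) : int := m i i.

(* The block may start at any position [k] of the quiddity row, and its length
   need not be a minimal period. *)
Definition quiddity_sequence (m : int -> int -> int) (s : seq int) : Prop :=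
  (0 < size s)%N /\
  exists k : int, forall i : int,
    quiddity m (k + i) = s`_(`|(i %% (size s)%:Z)%Z|%N).

(* Curves, up to homotopy, in the once-punctured disc with [N] marked points on
   its boundary, numbered counterclockwise by ['I_N].  The universal cover is
   the half-plane: the marked point [i] lifts to the boundary points [i + t * N]
   ([t : int]), and the puncture to the point at infinity, fixed by the deck
   translations.
   - [(i, Some l)] is the class whose lifts join [i + t * N] to
     [i + t * N + l]; it runs from [i] along [l] boundary segments, keeping the
     puncture on its left.  Every curve between boundary marked points is of
     this form for a unique [(i, l)] after reversing its orientation if needed
     (up to the choice of orientation, immaterial here, when [l = 0]).
   - [(i, None)] is the class of the segment from [i] to the puncture.
   A curve from the puncture to itself that does not cross itself bounds a disc
   without marked points, hence is contractible; such curves are left out. *)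
Definition curve (N : nat) : Type := 'I_N * option nat.

(* [l = 0] is a contractible curve and [l = 1] a boundary segment (the whole
   boundary circle if [N = 1]). *)
Definition essential (N : nat) (c : curve N) : bool :=
  if c.2 is Some l then (2 <= l)%N else true.

(* Two classes cross (i.e. have no representatives with disjoint interiors) iff
   some of their lifts are interlaced; for [c = d], with [l] the length, this is
   self-crossing, which happens iff [N < l]. *)
Definition crossing (N : nat) (c d : curve N) : Prop :=
  exists t : int,
    let x : int := (c.1 : nat)%:Z in
    let y : int := (d.1 : nat)%:Z + t * N%:Z in
    match c.2, d.2 with
    | Some l, Some l' =>
        [&& x < y, y < x + l%:Z & x + l%:Z < y + l'%:Z]
        || [&& y < x, x < y + l'%:Z & y + l'%:Z < x + l%:Z]
    | Some l, None => x < y < x + l%:Z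
    | None, Some l' => y < x < y + l'%:Z
    | None, None => false
    end.

(* Taking [c = d] in the second clause excludes self-crossing curves. *)
Definition noncrossing_arcs (N : nat) (T : {fset curve N}) : Prop :=
  (forall c, c \in T -> essential c) /\
  (forall c d, c \in T -> d \in T -> ~ crossing c d).

Definition triangulation (N : nat) (T : {fset curve N}) : Prop :=
  noncrossing_arcs T /\
  forall T' : {fset curve N}, noncrossing_arcs T' -> (T `<=` T')%fset -> T' = T.

(* A loop based at [p] has two ends at [p]. *)
Definition ends_at (N : nat) (p : 'I_N) (c : curve N) : nat :=
  ((c.1 == p) + (if c.2 is Some l then (c.1 + l) %% N == p else false))%N.

Definition triangulation_quiddity (N : nat) (T : {fset curve N}) (p : 'I_N) :
    nat :=
  (1 + \sum_(c <- T) ends_at p c)%N.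

Definition arises_from_punctured_disc (m : int -> int -> int) : Prop :=
  exists (N : nat) (T : {fset curve N}),
    [/\ (0 < N)%N, triangulation T
      & quiddity_sequence m
          [seq (triangulation_quiddity T p)%:Z | p <- enum 'I_N]].

(* Main.v *)
(* Write [a_i] for the quiddity row.  The frieze entries are determinants
   [det(u_i, u_j)] of vectors of [Z^2] with [u_(i-1) + u_(i+1) = a_i u_i], and
   [s_k] is the trace of the monodromy over [k n] steps.  Positivity forces
   [s_k >= 2] (otherwise the integers [det(u_0, u_(qkn))], [q >= 1], would
   decrease forever), and [s_k = 2] holds iff the recurrence
   [f_(i-1) + f_(i+1) = a_i f_i] has a positive [kn]-periodic solution [f].
   Averaging [f] over shifts by [n] shows that this does not depend on [k].

   A triangulation of the punctured disc yields such an [f]: put 1 at the ends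
   of the arcs to the puncture, and let the middle vertex of each lifted
   triangle carry the sum of the values at the other two.  Conversely, given
   [f] with coprime consecutive values, the curves [(i, j)] with
   [det(u_i, u_j) = 1] and the arcs to the puncture at the [i] with [f_i = 1]
   do not cross (Ptolemy's relation), and at least [a_i - 1] ends of them lie
   at [i] (an integer point at height 1 cannot be strictly inside the cone of
   [u_j] and [u_(j+1)]).  Extend them to a triangulation, with quiddity
   [b >= a] and positive periodic solution [g]; the Wronskian of [f] and [g] is
   monotone and periodic, so [b = a]. *)
Require Import Defs.
From mathcomp Require Import all_boot all_order all_algebra finmap.
From mathcomp Require Import zify ring.

Set Implicit Arguments.
Unset Strict Implicit.
Unset Printing Implicit Defensive.

Import Order.TTheory GRing.Theory Num.Theory.
Local Open Scope ring_scope.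

(** * Linear recurrences of order two *)

Definition solution (a v : int -> int) : Prop :=
  forall i, v (i + 1) = a i * v i - v (i - 1).

Lemma solution_unique (a v w : int -> int) (j : int) :
  solution a v -> solution a w -> v j = w j -> v (j + 1) = w (j + 1) ->
  v =1 w.
Proof.
move=> hv hw h0 h1.
have fwd (n : nat) : v (j + n) = w (j + n) /\ v (j + n + 1) = w (j + n + 1).
  elim: n => [|n [IH0 IH1]]; first by rewrite addr0.
  rewrite (_ : j + n.+1 = j + n + 1); last by lia.
  by split=> //; rewrite hv hw addrK IH0 IH1.
have bwd (n : nat) :
    v (j - n%:Z) = w (j - n%:Z) /\ v (j - n%:Z + 1) = w (j - n%:Z + 1).
  elim: n => [|n [IH0 IH1]]; first by rewrite subr0.
  rewrite (_ : j - n.+1%:Z + 1 = j - n%:Z); last by lia.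
  split=> //; rewrite (_ : j - n.+1%:Z = j - n%:Z - 1); last by lia.
  have back u : solution a u ->
      u (j - n%:Z - 1) = a (j - n%:Z) * u (j - n%:Z) - u (j - n%:Z + 1).
    by move=> hu; rewrite hu; ring.
  by rewrite !back // IH0 IH1.
move=> i; have [le_ji|lt_ij] := lerP j i.
  by have [+ _] := fwd `|i - j|%N; congr (v _ = w _); lia.
by have [+ _] := bwd `|i - j|%N; congr (v _ = w _); lia.
Qed.

Lemma solution_lin (a v w : int -> int) (x y : int) :
  solution a v -> solution a w -> solution a (fun i => x * v i + y * w i).
Proof. by move=> hv hw i; rewrite hv hw; ring. Qed.

Lemma solution_shift (a v : int -> int) (k : int) :
  (forall i, a (i + k) = a i) -> solution a v ->
  solution a (fun i => v (i + k)).
Proof.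
by move=> ak hv i; rewrite -(ak i) addrAC hv; congr (_ - v _); lia.
Qed.

Lemma solution_exists (a : int -> int) (j x y : int) :
  exists v, [/\ solution a v, v j = x & v (j + 1) = y].
Proof.
suff [v [v0 v1 vm1 vS vN]] : exists v : int -> int,
    [/\ v 0 = x, v 1 = y, v (- 1) = a j * x - y,
      forall n : nat, v n.+2%:Z = a (j + n.+1%:Z) * v n.+1%:Z - v n%:Z
    & forall n : nat,
        v (- n.+2%:Z) = a (j - n.+1%:Z) * v (- n.+1%:Z) - v (- n%:Z)].
  exists (fun i => v (i - j)); split=> [i||].
  - have -> : a i = a (j + (i - j)) by congr a; lia.
    rewrite ![i + _ - j]addrAC; move: (i - j) => {}i.
    case: (intP i) => [|n|n].
    + by rewrite addr0 add0r sub0r v0 v1 vm1 subKr.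
    + have -> : n.+1%:Z + 1 = n.+2%:Z by lia.
      by have -> : n.+1%:Z - 1 = n%:Z by lia.
    + have -> : - n.+1%:Z + 1 = - n%:Z by lia.
      have -> : - n.+1%:Z - 1 = - n.+2%:Z by lia.
      by rewrite vN subKr.
  - by rewrite subrr.
  - by rewrite addrAC subrr add0r.
pose fwd n :=
  iteri n (fun k p => (p.2, a (j + k.+1%:Z) * p.2 - p.1)) (x, y).
pose bwd n :=
  iteri n (fun k p => (p.2, a (j - k.+1%:Z) * p.2 - p.1)) (x, a j * x - y).
exists (fun i => if i is Posz n then (fwd n).1 else (bwd `|i|%N).1).
by split=> // -[|n].
Qed.

Lemma periodicM (T : Type) (f : int -> T) (N i q : int) :
  (forall i, f (i + N) = f i) -> f (i + q * N) = f i.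
Proof.
move=> fN; elim/int_ind: q => [|q IH|q IH]; first by rewrite mul0r addr0.
  by rewrite -IH -(fN (i + q%:Z * N)); congr f; lia.
by rewrite -IH -(fN (i + - q.+1%:Z * N)); congr f; lia.
Qed.

(** * Wronskians, and frieze entries as determinants *)

Definition wronskian (v w : int -> int) (i j : int) : int :=
  v i * w j - v j * w i.

(** Two coefficient sequences are allowed: [a = b] gives constancy, [a <= b] the monotonicity in the
    Sturm comparison. *)
Lemma wronskian_step (a b v w : int -> int) (i : int) :
  solution a v -> solution b w ->
  wronskian v w i (i + 1) =
    wronskian v w (i - 1) i + v i * w i * (b i - a i).
Proof. by move=> hv hw; rewrite /wronskian hv hw; ring. Qed.

Lemma wronskian_const (a v w : int -> int) (i : int) :
  solution a v -> solution a w ->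
  wronskian v w i (i + 1) = wronskian v w 0 1.
Proof.
move=> hv hw.
have step k : wronskian v w k (k + 1) = wronskian v w (k - 1) k.
  by rewrite (wronskian_step k hv hw); ring.
elim/int_ind: i => [|n IH|n IH]; first by rewrite add0r.
- by rewrite step -IH; congr wronskian; lia.
- by rewrite -IH [RHS]step; congr wronskian; lia.
Qed.

(* The solutions [X] and [Y] are the coordinates of a bi-infinite sequence of
   vectors [u_i] of [Z^2] with [a i * u_i = u_(i-1) + u_(i+1)]; the frieze
   entries are the determinants [det(u_i, u_j)]. *)
Record frieze_vectors (a X Y : int -> int) : Prop := FriezeVectors {
  fv_X : solution a X;
  fv_Y : solution a Y;
  fv_X0 : X 0 = 1;
  fv_X1 : X 1 = 0;
  fv_Y0 : Y 0 = 0;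
  fv_Y1 : Y 1 = 1;
  fv_gt0 : forall i j, i < j -> 0 < wronskian X Y i j
}.

Lemma solution_coord (a X Y v : int -> int) (k : int) :
  frieze_vectors a X Y -> solution a v -> v k = v 0 * X k + v 1 * Y k.
Proof.
case=> hX hY X0 X1 Y0 Y1 _ hv.
apply: (solution_unique (j := 0) hv (solution_lin (v 0) (v 1) hX hY)).
  by rewrite X0 Y0; ring.
by rewrite add0r X1 Y1; ring.
Qed.

Lemma wronskian1 (a X Y : int -> int) (i : int) :
  frieze_vectors a X Y -> wronskian X Y i (i + 1) = 1.
Proof.
case=> hX hY X0 X1 Y0 Y1 _; rewrite (wronskian_const i hX hY) /wronskian.
by rewrite X0 X1 Y0 Y1.
Qed.

(** [v] is a linear form evaluated on the vectors [(X k, Y k)], and this is Cramer's rule in the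
    plane. *)
Lemma solution_three_terms (a X Y v : int -> int) (i j k : int) :
  frieze_vectors a X Y -> solution a v ->
  v k * wronskian X Y i j = v i * wronskian X Y k j + v j * wronskian X Y i k.
Proof.
move=> hXY hv; rewrite /wronskian.
have c l := solution_coord l hXY hv.
by rewrite (c k) (c i) (c j); ring.
Qed.

Lemma ptolemy (X Y : int -> int) (i j k l : int) :
  let D := wronskian X Y in D i k * D j l = D i j * D k l + D i l * D j k.
Proof. by rewrite /wronskian /=; ring. Qed.

(** The shift acts on the vectors by a matrix of determinant [wronskian X Y N (N + 1) = 1]. *)
Lemma wronskian_shift (a X Y : int -> int) (N i j : int) :
  frieze_vectors a X Y -> (forall i, a (i + N) = a i) ->
  wronskian X Y (i + N) (j + N) = wronskian X Y i j.
Proof.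
move=> hXY aN; have [hX hY _ _ _ _ _] := hXY.
have cX k := solution_coord k hXY (solution_shift aN hX).
have cY k := solution_coord k hXY (solution_shift aN hY).
have := wronskian1 N hXY; rewrite /wronskian (cX i) (cY i) (cX j) (cY j).
rewrite !add0r [1 + N]addrC => h.
transitivity ((X N * Y (N + 1) - X (N + 1) * Y N) * (X i * Y j - X j * Y i)).
  by ring.
by rewrite h mul1r.
Qed.

(** Induction on [j - i]: the difference of two adjacent diamonds, with the recurrence for [i + 1],
    is the claim times the positive entry [m (i + 1) (j - 1)]. *)
Lemma frieze_recurrence (m : int -> int -> int) (i j : int) :
  infinite_frieze m -> i <= j ->
  m i j = m j j * m i (j - 1) - m i (j - 2).
Proof.
case=> m0 m1 mpos mdet leij.
have -> : i = j - (`|j - i|%N)%:Z by lia.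
elim: `|j - i|%N => [|n IH].
  by rewrite subr0 m0 m1; ring.
set k := j - n%:Z in IH; have -> : j - n.+1%:Z = k - 1 by lia.
have gt0 : 0 < m k (j - 1) by apply: mpos; lia.
have d1 := mdet (k - 1) (j - 1) ltac:(lia).
have d2 := mdet (k - 1) (j - 2) ltac:(lia).
rewrite !subrK in d1 d2; rewrite (_ : j - 2 + 1 = j - 1) in d2; last by lia.
apply: (mulfI (lt0r_neq0 gt0)).
rewrite IH in d1.
have /eqP := etrans d2 (esym d1); rewrite -subr_eq0 => /eqP d.
by apply: subr0_eq; rewrite -d; ring.
Qed.

Lemma frieze_vectors_exists (m : int -> int -> int) :
  infinite_frieze m ->
  exists X Y, frieze_vectors (quiddity m) X Y /\
    forall i j, i <= j -> m (i + 1) (j - 1) = wronskian X Y i j.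
Proof.
move=> hm; have [m0 m1 mpos _] := hm.
have [X [hX X0 X1]] := solution_exists (quiddity m) 0 1 0.
have [Y [hY Y0 Y1]] := solution_exists (quiddity m) 0 0 1.
rewrite !add0r in X1 Y1.
have mE i j : i <= j -> m (i + 1) (j - 1) = wronskian X Y i j.
  move=> leij; have -> : j = i + `|j - i|%N%:Z by lia.
  suff [] : m (i + 1) (i + `|j - i|%N%:Z - 1) =
      wronskian X Y i (i + `|j - i|%N%:Z) /\
      m (i + 1) (i + `|j - i|%N%:Z) =
        wronskian X Y i (i + `|j - i|%N%:Z + 1) by [].
  elim: `|j - i|%N => [|n [IH0 IH1]].
    rewrite addr0 (wronskian_const i hX hY) /wronskian X0 X1 Y0 Y1.
    have -> : i - 1 = i + 1 - 2 by lia.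
    by have := m1 (i + 1); rewrite m0 addrK => ->; split; ring.
  rewrite (_ : i + n.+1%:Z = i + n%:Z + 1) ?addrK; last by lia.
  split=> //; rewrite frieze_recurrence //; last by lia.
  rewrite addrK (_ : i + n%:Z + 1 - 2 = i + n%:Z - 1) ?IH0 ?IH1; last by lia.
  by rewrite /wronskian (hX (_ + 1)) (hY (_ + 1)) /quiddity addrK; ring.
exists X, Y; split=> //; split=> // i j ltij.
by rewrite -mE; [apply: mpos; lia|lia].
Qed.

(** * Trace of the monodromy and periodic solutions *)

Record positive_periodic (a f : int -> int) (N : int) : Prop :=
  PositivePeriodic {
  pp_solution : solution a f;
  pp_periodic : forall i, f (i + N) = f i;
  pp_gt0 : forall i, 0 < f i
}.

(* The trace of the monodromy [u_i |-> u_(i+N)] of the vectors [u_i]. *)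
Definition trace (X Y : int -> int) (N : int) : int :=
  wronskian X Y 0 (N + 1) - wronskian X Y 1 N.

(** [f] is a linear form invariant under the monodromy, so 1 is an eigenvalue; with determinant 1
    the trace is 2. *)
Lemma periodic_trace (a X Y f : int -> int) (N : int) :
  frieze_vectors a X Y -> positive_periodic a f N -> trace X Y N = 2.
Proof.
move=> hXY [hf fN fpos].
have e0 := solution_coord N hXY hf; have e1 := solution_coord (N + 1) hXY hf.
have d := wronskian1 N hXY.
have [_ _ X0 X1 Y0 Y1 _] := hXY.
rewrite -[N]add0r fN add0r in e0; rewrite addrC fN addrC in e1.
rewrite /trace /wronskian X0 X1 Y0 Y1 in d *.
have {}e0 : (1 - X N) * f 0 = f 1 * Y N by rewrite mulrBl mul1r {1}e0; ring.
have {}e1 : (1 - Y (N + 1)) * f 1 = f 0 * X (N + 1).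
  by rewrite mulrBl mul1r {1}e1; ring.
have : (f 0 * f 1) * ((1 - X N) * (1 - Y (N + 1)))
     = (f 0 * f 1) * (X (N + 1) * Y N).
  transitivity (((1 - X N) * f 0) * ((1 - Y (N + 1)) * f 1)); first by ring.
  by rewrite e0 e1; ring.
by move/(mulfI (lt0r_neq0 (mulr_gt0 (fpos 0) (fpos 1)))); lia.
Qed.

(** Cayley-Hamilton for the monodromy, of determinant 1. *)
Lemma solution_trace (a X Y v : int -> int) (N k : int) :
  frieze_vectors a X Y -> (forall i, a (i + N) = a i) -> solution a v ->
  v (k + N + N) = trace X Y N * v (k + N) - v k.
Proof.
move=> hXY aN hv; have [hX hY X0 X1 Y0 Y1 _] := hXY.
have cX l := solution_coord l hXY (solution_shift aN hX).
have cY l := solution_coord l hXY (solution_shift aN hY).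
have cv l := solution_coord l hXY hv.
rewrite (cv (k + N + N)) (cv (k + N)) (cv k) (cX (k + N)) (cY (k + N)).
rewrite (cX k) (cY k).
rewrite !add0r [1 + N]addrC /trace.
have d := wronskian1 N hXY.
rewrite /wronskian X0 X1 Y0 Y1 in d *.
pose w := v 0 * X k + v 1 * Y k.
apply: subr0_eq.
transitivity (w * (1 - (X N * Y (N + 1) - X (N + 1) * Y N))); rewrite /w.
  by ring.
by rewrite d subrr mulr0.
Qed.

Lemma trace_ge2 (a X Y : int -> int) (N : int) :
  frieze_vectors a X Y -> 0 < N -> (forall i, a (i + N) = a i) ->
  2 <= trace X Y N.
Proof.
move=> hXY N0 aN; rewrite leNgt; apply/negP => lt2.
have [_ hY X0 X1 Y0 Y1 Dpos] := hXY.
pose u (q : nat) := Y (q%:Z * N).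
have u0 : u 0%N = 0 by rewrite /u mul0r.
have u_gt0 q : 0 < u q.+1.
  have /Dpos : 0 < q.+1%:Z * N by rewrite mulr_gt0.
  by rewrite /wronskian X0 Y0 mulr0 subr0 mul1r.
have uSS q : u q.+2 = trace X Y N * u q.+1 - u q.
  rewrite /u (_ : q.+2%:Z * N = q%:Z * N + N + N); last by lia.
  rewrite (_ : q.+1%:Z * N = q%:Z * N + N); last by lia.
  exact: solution_trace hXY aN hY.
have le_u q : trace X Y N * u q.+1 <= 1 * u q.+1.
  by apply: ler_wpM2r; [exact: ltW|lia].
(* Since the trace is at most 1, [u q.+2 <= u q.+1 - u q], which loses at least 1 per step once
   [q > 0]. *)
have desc q : u q.+2 <= u 1%N - q%:Z.
  elim: q => [|q IH].
    by have := uSS 0%N; have := le_u 0%N; rewrite u0; lia.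
  by have := uSS q.+1; have := le_u q.+1; have := u_gt0 q; lia.
by have := desc `|u 1%N|%N; have := u_gt0 `|u 1%N|%N.+1; lia.
Qed.

(** At trace 2 the monodromy is unipotent, so the increment of [Y] over a period is itself periodic.
    It is the slope of [Y] along a class modulo [N], and [Y] is positive on positive indices. *)
Lemma positive_periodic_exists (a X Y : int -> int) (N : int) :
  frieze_vectors a X Y -> 0 < N -> (forall i, a (i + N) = a i) ->
  trace X Y N <= 2 -> exists f, positive_periodic a f N.
Proof.
move=> hXY N0 aN tr_le; have [_ hY X0 X1 Y0 Y1 Dpos] := hXY.
have tr2 : trace X Y N = 2.
  by apply/eqP; rewrite eq_le tr_le (trace_ge2 hXY).
have [f fE] : exists f : int -> int, forall k : int, f k = Y (k + N) - Y k.
  by eexists.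
have fN k : f (k + N) = f k.
  by rewrite !fE (solution_trace k hXY aN hY) tr2; ring.
have hf : solution a f.
  by move=> i; rewrite !fE (solution_shift aN hY) hY; ring.
have Yf k (q : nat) : Y (k + q%:Z * N) = Y k + q%:Z * f k.
  elim: q => [|q IH]; first by rewrite !mul0r !addr0.
  have fq : f (k + q%:Z * N) = f k by apply: periodicM.
  rewrite (_ : k + q.+1%:Z * N = k + q%:Z * N + N); last by lia.
  move: fq; rewrite {1}fE => /eqP; rewrite subr_eq IH => /eqP ->.
  by rewrite intS; ring.
have Ypos k : 0 < k -> 0 < Y k.
  by move=> /Dpos; rewrite /wronskian X0 Y0 mulr0 subr0 mul1r.
have f_ge0 k : 0 <= f k.
  rewrite leNgt; apply/negP => flt.
  (* Large enough for [k + q * N] to be positive and [Y k + q * f k] negative. *)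
  pose q := (`|Y k| + `|k|).+1; have Ykq : Y k < q%:Z by lia.
  have le1 : q%:Z * 1 <= q%:Z * N by apply: ler_wpM2l; lia.
  have le2 : q%:Z * f k <= q%:Z * (- 1) by apply: ler_wpM2l; lia.
  have := Ypos (k + q%:Z * N); rewrite Yf.
  by lia.
(* At a zero the two nonnegative neighbours sum to 0; two consecutive zeros give [f 0 = 0], but
   [f 0 = Y N > 0]. *)
exists f; split=> // k; rewrite lt_neqAle f_ge0 andbT; apply/eqP => fk.
have fk1 : f (k + 1) = 0.
  have := hf k; have := f_ge0 (k + 1); have := f_ge0 (k - 1).
  by rewrite -fk mulr0 sub0r; move: (f (k + 1)) (f (k - 1)) => x y; lia.
have := solution_three_terms k (k + 1) 0 hXY hf.
rewrite fk1 -fk (wronskian1 _ hXY) !mul0r addr0 mulr1 fE add0r Y0 subr0.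
by have := Ypos _ N0; lia.
Qed.

(** Consecutive vectors have determinant 1, so every value is an integer combination of [f i] and
    [f (i + 1)]. *)
Lemma solution_dvd (a X Y f : int -> int) (d i k : int) :
  frieze_vectors a X Y -> solution a f ->
  (d %| f i)%Z -> (d %| f (i + 1))%Z -> (d %| f k)%Z.
Proof.
move=> hXY hf di di1; have := solution_three_terms i (i + 1) k hXY hf.
by rewrite (wronskian1 _ hXY) mulr1 => ->; rewrite rpredD // dvdz_mulr.
Qed.

(** Divide by the gcd of two consecutive values: a value dividing its successor then divides all
    values, hence is 1. *)
Lemma primitive_periodic_exists (a X Y : int -> int) (N : int) :
  frieze_vectors a X Y -> 0 < N -> (forall i, a (i + N) = a i) ->
  trace X Y N <= 2 ->
  exists2 f, positive_periodic a f N &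
    forall i, (f i %| f (i + 1))%Z -> f i = 1.
Proof.
move=> hXY N0 aN tr_le.
have [f [hf fN fpos]] := positive_periodic_exists hXY N0 aN tr_le.
pose g := gcdz (f 0) (f 1).
have g0 : 0 < g.
  have : (0 <= g) by [].
  rewrite le_eqVlt => /orP[|//]; rewrite eq_sym gcdz_eq0 => /andP[/eqP h _].
  by have := fpos 0; rewrite h.
have gdvd k : (g %| f k)%Z.
  by apply: (solution_dvd (i := 0) k hXY hf); rewrite ?dvdz_gcdl ?dvdz_gcdr.
pose h k := (f k %/ g)%Z.
have fh k : f k = h k * g by rewrite divzK.
have gn0 : g != 0 by rewrite gt_eqF.
exists h.
  split=> [i|i|i].
  - by apply: (mulIf gn0); rewrite mulrBl -mulrA -!fh hf.
  - by rewrite /h fN.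
  - by have := fpos i; rewrite fh pmulr_lgt0.
move=> i dvd1.
have dvdf k : (f i %| f k)%Z.
  by apply: (solution_dvd (i := i) k hXY hf); rewrite // !fh dvdz_mul2r ?gn0.
have : (h i * g %| 1 * g)%Z by rewrite -fh mul1r dvdz_gcd !dvdf.
rewrite dvdz_mul2r ?gn0 // dvdz1 => /eqP.
by have := fpos i; rewrite fh pmulr_lgt0 //; lia.
Qed.

(** * Lifted triangulations *)

(* The lift of a triangulation to the universal cover: [E i j] says that the
   boundary points [i < j] are joined by a boundary segment or by the lift of an
   arc, and [P i] that [i] is joined to the puncture. *)
Record lifted_triangulation (N : nat) (E : int -> int -> bool)
    (P : int -> bool) : Prop := LiftedTriangulation {
  lt_N : (0 < N)%N;
  lt_E_shift : forall i j, E (i + N%:Z) (j + N%:Z) = E i j;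
  lt_P_shift : forall i, P (i + N%:Z) = P i;
  lt_lt : forall i j, E i j -> i < j;
  lt_side : forall i, E i (i + 1);
  lt_E_nocross : forall i j k l, E i j -> E k l -> ~~ [&& i < k, k < j & j < l];
  lt_P_nocross : forall i j k, E i j -> P k -> ~~ (i < k < j);
  lt_E_max : forall i j, i < j -> j <= i + N%:Z ->
    (forall k l, E k l ->
       ~~ ([&& i < k, k < j & j < l] || [&& k < i, i < l & l < j])) ->
    (forall k, P k -> ~~ (i < k < j)) -> E i j;
  lt_P_max : forall k, (forall i j, E i j -> ~~ (i < k < j)) -> P k
}.

(** Lengths start at 2 because boundary segments satisfy [E] but have no arc end. *)
Definition right_arcs (E : int -> int -> bool) (i : int) (d : nat) : nat :=
  (\sum_(2 <= l < d.+1) E i (i + l%:Z)%R)%N.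

Definition left_arcs (E : int -> int -> bool) (i : int) (d : nat) : nat :=
  (\sum_(2 <= l < d.+1) E (i - l%:Z)%R i)%N.

Lemma sum_bool_trunc (F : nat -> bool) (e d : nat) : (0 < e <= d)%N ->
  (forall l, (e < l <= d)%N -> ~~ F l) ->
  (\sum_(2 <= l < d.+1) F l = \sum_(2 <= l < e.+1) F l)%N.
Proof.
move=> le_ed F0; rewrite (@big_cat_nat _ _ _ e.+1) //=; [|lia..].
rewrite [X in (_ + X)%N]big_nat [X in (_ + X)%N]big1 ?addn0 // => l hl.
by rewrite (negbTE (F0 l _)) //; lia.
Qed.

Lemma sum_bool_last (F : nat -> bool) (e d : nat) : (0 < e < d)%N ->
  (forall l, (e < l < d)%N -> ~~ F l) -> F d ->
  (\sum_(2 <= l < d.+1) F l = (\sum_(2 <= l < e.+1) F l).+1)%N.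
Proof.
case: d => [|d] le_ed F0 Fd; first by lia.
rewrite big_nat_recr /=; last by lia.
by rewrite Fd addn1 (@sum_bool_trunc F e d) // => l hl; apply: F0; lia.
Qed.

Section LiftedTriangulation.

Variables (N : nat) (E : int -> int -> bool) (P : int -> bool).
Hypothesis hT : lifted_triangulation N E P.

(** A longer edge would cross its translate by [N]. *)
Lemma lt_length i j : E i j -> j <= i + N%:Z.
Proof.
move=> Eij; rewrite leNgt; apply/negP => ltj.
have := lt_E_nocross hT Eij; move: (Eij); rewrite -(lt_E_shift hT) => Eij' h.
by have := h _ _ Eij'; have := lt_N hT; lia.
Qed.

(** [j + e] is the apex of the triangle under the edge: the farthest neighbour of [j] before
    [j + d]. *)
Lemma lt_apex (j : int) (d : nat) : (1 < d)%N -> E j (j + d%:Z) ->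
  exists e : nat, [/\ (0 < e < d)%N, E j (j + e%:Z), E (j + e%:Z) (j + d%:Z)
    & forall l : nat, (e < l < d)%N -> ~~ E j (j + l%:Z)].
Proof.
move=> d1 Ejd.
pose Q e := (0 < e < d)%N && E j (j + e%:Z).
have exQ : exists e, Q e by exists 1%N; rewrite /Q d1 (lt_side hT).
have leQ e : Q e -> (e <= d)%N by move=> /andP[+ _]; lia.
have [e /andP[e_d Eje] emax] := ex_maxnP exQ leQ.
have e_last l : (e < l < d)%N -> ~~ E j (j + l%:Z).
  move=> hl; apply/negP => Ejl; have := emax l; rewrite /Q Ejl andbT; lia.
exists e; split=> //; apply: (lt_E_max hT); first by lia.
- by have := lt_length Ejd; lia.
(* An edge crossing the missing side without crossing the two known ones starts at [j], which the
   choice of [e] excludes. *)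
- move=> k l Ekl; apply/negP => cr.
  have := lt_E_nocross hT Ejd Ekl; have := lt_E_nocross hT Ekl Ejd.
  have := lt_E_nocross hT Eje Ekl; have := lt_lt hT Ekl.
  have [kj|kj] := eqVneq k j; last by lia.
  move: Ekl; rewrite kj (_ : l = j + `|l - j|%N%:Z); last by lia.
  by move=> Ejl _; have := e_last `|l - j|%N; rewrite Ejl; lia.
- by move=> k Pk; have := lt_P_nocross hT Ejd Pk; lia.
Qed.

(** The bound on edge lengths makes the search for a covering edge finite. *)
Lemma lt_cover (k : int) : ~~ P k -> exists i j, E i j /\ i < k < j.
Proof.
move=> nPk.
have [/existsP[x /existsP[y /andP[Exy kxy]]]|] := boolP [exists x : 'I_N.+1,
  [exists y : 'I_N.+1, E (k - x%:Z) (k + y%:Z) && (k - x%:Z < k < k + y%:Z)]].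
  by exists (k - x%:Z), (k + y%:Z).
move=> /existsPn nE.
have {}nE (x y : nat) : (x < N.+1)%N -> (y < N.+1)%N ->
    ~~ (E (k - x%:Z) (k + y%:Z) && (k - x%:Z < k < k + y%:Z)).
  by move=> xN yN; have /existsPn /(_ (Ordinal yN)) := nE (Ordinal xN).
case/negP: nPk; apply: (lt_P_max hT) => i j Eij.
apply/negP => hk; have := lt_length Eij => lj.
have := nE `|k - i|%N `|j - k|%N ltac:(lia) ltac:(lia).
have -> : k - `|k - i|%N%:Z = i by lia.
have -> : k + `|j - k|%N%:Z = j by lia.
by rewrite Eij hk.
Qed.

(** Otherwise the left end of each edge lies under another, strictly longer edge, and lengths would
    exceed [N]. *)
Lemma puncture_arc_exists : exists j, P j.
Proof.
suff [//|[i [j [/lt_length]]]] :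
  (exists j, P j) \/ exists i j, E i j /\ i + N%:Z < j by lia.
elim: {1}N => [|d [|[i [j [Eij ltj]]]]]; last 2 first.
- by left.
- have [Pi|nPi] := boolP (P i); first by left; exists i.
  right; have [x [y [Exy ixy]]] := lt_cover nPi; exists x, y; split=> //.
  by have := lt_E_nocross hT Exy Eij; lia.
by right; exists 0, 1; rewrite (lt_side hT 0).
Qed.

(** An edge closes the sector between consecutive puncture arcs, which confine the arcs entering it.
    With a single puncture arc, [d = N]. *)
Lemma next_puncture_arc (j : int) : P j -> exists d : nat,
  [/\ (0 < d <= N)%N, P (j + d%:Z), E j (j + d%:Z),
     forall e : nat, (0 < e < d)%N -> ~~ P (j + e%:Z)
   & right_arcs E j N = right_arcs E j d /\
     left_arcs E (j + d%:Z) N = left_arcs E (j + d%:Z) d].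
Proof.
move=> Pj; pose Q d := (0 < d)%N && P (j + d%:Z).
have QN : Q N by rewrite /Q (lt_N hT) (lt_P_shift hT).
have exQ : exists d, Q d by exists N.
have [d /andP[d0 Pd] dmin] := ex_minnP exQ.
have dN := dmin N QN.
have nP e : (0 < e < d)%N -> ~~ P (j + e%:Z).
  by move=> he; apply/negP => Pe; have := dmin e; rewrite /Q Pe; lia.
exists d; split=> //; first by rewrite d0.
  apply: (lt_E_max hT); [lia|lia| |].
    move=> k l Ekl; have := lt_P_nocross hT Ekl Pj.
    by have := lt_P_nocross hT Ekl Pd; have := lt_lt hT Ekl; lia.
  move=> k Pk; apply/negP => hk; have := nP `|k - j|%N.
  rewrite (_ : j + `|k - j|%N%:Z = k) ?Pk; lia.
split; apply: sum_bool_trunc => [|l hl]; rewrite ?d0 //.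
  by apply/negP => Ejl; have := lt_P_nocross hT Ejl Pd; lia.
by apply/negP => Ejl; have := lt_P_nocross hT Ejl Pj; lia.
Qed.

Variables (a v : int -> int).
Hypothesis aE : forall i,
  a i = (1 + right_arcs E i N + left_arcs E i N + P i)%N%:Z.
Hypothesis hv : solution a v.

(** Induction through the apex [u]: the two smaller fans give both neighbours of [u], and the
    recurrence at [u] leaves [v u = v j + v (j + d)]. *)
Lemma fan (d : nat) (j : int) : E j (j + d%:Z) ->
  [/\ v (j + 1) = (right_arcs E j d)%:Z * v j + v (j + d%:Z),
      v (j + d%:Z - 1) = (left_arcs E (j + d%:Z) d)%:Z * v (j + d%:Z) + v j
    & 0 < v j -> 0 < v (j + d%:Z) ->
      forall k, j < k < j + d%:Z -> 0 < v k].
Proof.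
elim/ltn_ind: d j => d IH j Ejd; have := lt_lt hT Ejd.
have [d1|d1] := leqP d 1.
  move=> ltj; have -> : d = 1%N by lia.
  rewrite /right_arcs /left_arcs !big_geq // !mul0r !add0r addrK.
  by split=> // _ _ k; lia.
move=> _; have [e [e_d Eje Eed e_last]] := lt_apex d1 Ejd.
pose u := j + e%:Z; pose c := (d - e)%N.
have uc : u + c%:Z = j + d%:Z by rewrite /u /c; lia.
have [IHj IHu posj] := IH e ltac:(lia) j Eje.
have [] := IH c ltac:(lia) u; rewrite uc // => IHu' IHd posu.
have dN := lt_length Ejd.
have Ru : right_arcs E u N = right_arcs E u c.
  apply: sum_bool_trunc => [|l hl]; first by lia.
  by apply/negP => Eul; have := lt_E_nocross hT Ejd Eul; lia.
have Lu : left_arcs E u N = left_arcs E u e.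
  apply: sum_bool_trunc => [|l hl]; first by lia.
  by apply/negP => Eul; have := lt_E_nocross hT Eul Ejd; lia.
have Pu : P u = false.
  by apply/negP => Pu; have := lt_P_nocross hT Ejd Pu; lia.
have vu : v u = v j + v (j + d%:Z).
  have := hv u; rewrite IHu' aE Ru Lu Pu IHu -/u => h.
  apply: (addrI ((right_arcs E u c)%:Z * v u)).
  rewrite addrCA h addn0 !PoszD; ring.
have Rj : right_arcs E j d = (right_arcs E j e).+1.
  by apply: sum_bool_last.
have Ld : left_arcs E (j + d%:Z) d = (left_arcs E (j + d%:Z) c).+1.
  apply: sum_bool_last => [|l hl|]; first by lia.
    by apply/negP => Ell; have := lt_E_nocross hT Eje Ell; lia.
  by rewrite addrK.
split.
- by rewrite IHj Rj -/u vu intS; ring.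
- by rewrite IHd Ld vu intS; ring.
- move=> vj vd k hk; have vu0 : 0 < v u by rewrite vu addr_gt0.
  have [ltk|ltk|->//] := ltgtP k u.
    by apply: posj => //; lia.
  by apply: posu => //; lia.
Qed.

(** The recurrence across a sector reproduces the same initial data at the next puncture arc. *)
Lemma fan_puncture (e : nat) (j : int) : P j -> P (j + e%:Z) ->
  v j = 1 -> v (j + 1) = 1 + (right_arcs E j N)%:Z ->
  [/\ v (j + e%:Z) = 1, v (j + e%:Z + 1) = 1 + (right_arcs E (j + e%:Z) N)%:Z
    & forall k, j <= k <= j + e%:Z -> 0 < v k].
Proof.
elim/ltn_ind: e j => e IH j Pj Pe vj vj1.
have [e0|e0] := posnP e.
  rewrite e0 addr0; split=> // k hk.
  by rewrite (_ : k = j) ?vj //; lia.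
have [d [d_N Pd Ed nP [Rj Ld]]] := next_puncture_arc Pj.
have le_de : (d <= e)%N.
  by rewrite leqNgt; apply/negP => lt_ed; have := nP e; rewrite Pe; lia.
have [fan1 fan2 fan3] := fan Ed.
have vd : v (j + d%:Z) = 1 by move: fan1; rewrite vj1 vj Rj; lia.
have vd1 : v (j + d%:Z + 1) = 1 + (right_arcs E (j + d%:Z) N)%:Z.
  by rewrite hv fan2 aE Pd vd vj Ld; lia.
have ed : j + d%:Z + (e - d)%N%:Z = j + e%:Z by lia.
have Pde : P (j + d%:Z + (e - d)%N%:Z) by rewrite ed.
have [] := IH (e - d)%N ltac:(lia) (j + d%:Z) Pd Pde vd vd1.
rewrite ed => ve ve1 posk.
split=> // k hk; have [ltk|lek] := ltrP k (j + d%:Z); last by apply: posk; lia.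
have [kj|kj] := eqVneq k j; first by rewrite kj vj.
by apply: fan3; rewrite ?vd ?vj //; lia.
Qed.

End LiftedTriangulation.

Lemma lifted_triangulation_periodic (N : nat) (E : int -> int -> bool)
    (P : int -> bool) (a : int -> int) :
  lifted_triangulation N E P ->
  (forall i, a i = (1 + right_arcs E i N + left_arcs E i N + P i)%N%:Z) ->
  exists f, positive_periodic a f N%:Z.
Proof.
move=> hT aE; have [j Pj] := puncture_arc_exists hT.
have R_shift i : right_arcs E (i + N%:Z) N = right_arcs E i N.
  by apply: eq_bigr => l _; rewrite addrAC (lt_E_shift hT).
have L_shift i : left_arcs E (i + N%:Z) N = left_arcs E i N.
  by apply: eq_bigr => l _; rewrite addrAC (lt_E_shift hT).
have [f [hf fj fj1]] := solution_exists a j 1 (1 + (right_arcs E j N)%:Z).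
have [] := fan_puncture hT aE hf (e := N) Pj _ fj fj1.
  by rewrite (lt_P_shift hT).
rewrite R_shift => fN fN1 fpos.
have f_shift : forall i, f (i + N%:Z) = f i.
  have aN i : a (i + N%:Z) = a i by rewrite !aE R_shift L_shift (lt_P_shift hT).
  apply: (solution_unique (j := j) (solution_shift aN hf) hf).
    by rewrite fN fj.
  by rewrite addrAC fN1 fj1.
exists f; split=> // i.
have N0 : 0 < N%:Z by have := lt_N hT; lia.
have := divz_eq (i - j) N%:Z; have := ltz_pmod (i - j) N0.
have := modz_ge0 (i - j) (lt0r_neq0 N0).
move: ((i - j) %/ N%:Z)%Z ((i - j) %% N%:Z)%Z => q r r0 rN ij.
have -> : i = j + r + q * N%:Z by lia.
by rewrite periodicM //; apply: fpos; lia.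
Qed.

(** * Curves in the punctured disc *)

Lemma residue_subproof (N : nat) (N0 : (0 < N)%N) (i : int) :
  (`|(i %% N%:Z)%Z| < N)%N.
Proof.
have NZ : 0 < N%:Z by lia.
by have := ltz_pmod i NZ; have := modz_ge0 i (lt0r_neq0 NZ); lia.
Qed.

Definition residue (N : nat) (N0 : (0 < N)%N) (i : int) : 'I_N :=
  Ordinal (residue_subproof N0 i).

Lemma residue_val (N : nat) (N0 : (0 < N)%N) (i : int) :
  (residue N0 i : nat)%:Z = (i %% N%:Z)%Z.
Proof.
have NZ : 0 < N%:Z by lia.
by have := modz_ge0 i (lt0r_neq0 NZ); rewrite /residue /=; lia.
Qed.

Lemma residue_ord (N : nat) (N0 : (0 < N)%N) (p : 'I_N) :
  residue N0 (p : nat)%:Z = p.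
Proof. by apply: val_inj; rewrite /= modz_nat modn_small. Qed.

Lemma residueMD (N : nat) (N0 : (0 < N)%N) (i t : int) :
  residue N0 (i + t * N%:Z) = residue N0 i.
Proof. by apply: val_inj; rewrite /= addrC modzMDl. Qed.

Lemma residue_eq (N : nat) (N0 : (0 < N)%N) (i j : int) :
  (residue N0 i == residue N0 j) = (i == j %[mod N%:Z])%Z.
Proof. by rewrite -!(residue_val N0). Qed.

Lemma residue_lift (N : nat) (N0 : (0 < N)%N) (i : int) :
  exists t : int, i = (residue N0 i : nat)%:Z + t * N%:Z.
Proof.
by exists (i %/ N%:Z)%Z; rewrite residue_val addrC -divz_eq.
Qed.

(** Unlike in [crossing], the base points are arbitrary integers, so lifts can be translated
    freely. *)
Definition interlaced (x : int) (o : option nat) (y : int) (o' : option nat) :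
    bool :=
  match o, o' with
  | Some l, Some l' =>
      [&& x < y, y < x + l%:Z & x + l%:Z < y + l'%:Z]
      || [&& y < x, x < y + l'%:Z & y + l'%:Z < x + l%:Z]
  | Some l, None => x < y < x + l%:Z
  | None, Some l' => y < x < y + l'%:Z
  | None, None => false
  end.

Lemma interlacedD (s x y : int) (o o' : option nat) :
  interlaced (x + s) o (y + s) o' = interlaced x o y o'.
Proof. by case: o o' => [l|] [l'|] //=; lia. Qed.

Lemma crossingE (N : nat) (c d : curve N) :
  crossing c d <->
  exists t : int, interlaced (c.1 : nat)%:Z c.2 ((d.1 : nat)%:Z + t * N%:Z) d.2.
Proof.
by split=> -[t ht]; exists t; move: ht => /=; case: (c.2) (d.2) => [l|] [l'|].
Qed.

Lemma crossing_residue (N : nat) (N0 : (0 < N)%N) (i j : int)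
    (o o' : option nat) :
  crossing (residue N0 i, o) (residue N0 j, o') <->
  exists t : int, interlaced i o (j + t * N%:Z) o'.
Proof.
have [q iq] := residue_lift N0 i; have [r jr] := residue_lift N0 j.
rewrite crossingE; split=> -[t ht].
  exists (t + q - r).
  have -> : j + (t + q - r) * N%:Z =
      (residue N0 j : nat)%:Z + t * N%:Z + q * N%:Z by rewrite {1}jr; ring.
  by rewrite {1}iq interlacedD.
exists (t + r - q); move: ht.
have -> : j + t * N%:Z =
    (residue N0 j : nat)%:Z + (t + r - q) * N%:Z + q * N%:Z.
  by rewrite {1}jr; ring.
by rewrite {1}iq interlacedD.
Qed.

Lemma crossing_sym (N : nat) (c d : curve N) : crossing c d -> crossing d c.
Proof.
move=> /crossingE[t]; rewrite -(interlacedD (- t * N%:Z)) mulNr addrK => ht.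
apply/crossingE; exists (- t); move: ht; rewrite mulNr /interlaced.
by case: (c.2) (d.2) => [l|] [l'|] //; rewrite orbC.
Qed.

Definition lifted_edge (N : nat) (N0 : (0 < N)%N) (T : {fset curve N})
    (i j : int) : bool :=
  (i < j) && ((j == i + 1) || ((residue N0 i, Some `|j - i|%N) \in T)).

Definition lifted_puncture_arc (N : nat) (N0 : (0 < N)%N)
    (T : {fset curve N}) (i : int) : bool :=
  (residue N0 i, None) \in T.

Lemma triangulation_mem (N : nat) (T : {fset curve N}) (c : curve N) :
  triangulation T -> essential c -> ~ crossing c c ->
  (forall d, d \in T -> ~ crossing c d) -> c \in T.
Proof.
move=> [[Tess Tnc] Tmax] ess_c ncc ncT.
rewrite -(Tmax (c |` T)%fset); [exact: fset1U1| |exact: fsubsetU1].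
split=> [d|d e].
  by move=> /fset1UP[->|/Tess].
move=> /fset1UP[->|dT] /fset1UP[->|eT] //; [exact: ncT| |exact: Tnc].
by move=> /crossing_sym; apply: ncT.
Qed.

Lemma noncrossing_length (N : nat) (T : {fset curve N}) (i : 'I_N) (l : nat) :
  noncrossing_arcs T -> (i, Some l) \in T -> (2 <= l <= N)%N.
Proof.
move=> [Tess Tnc] iT; have := Tess _ iT; rewrite /essential /= => ->.
rewrite leqNgt; apply/negP => ltl.
have N0 : (0 < N)%N by case: (i) => k; lia.
by apply: (Tnc _ _ iT iT); exists 1; rewrite /=; lia.
Qed.

(* Contains every non-crossing family of arcs: an arc longer than the boundary
   crosses itself. *)
Definition short_curves (N : nat) : seq (curve N) :=
  [seq (q, o) | q <- enum 'I_N,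
                o <- None :: [seq Some l | l <- index_iota 2 N.+1]].

Lemma mem_short_curves (N : nat) (q : 'I_N) (o : option nat) :
  ((q, o) \in short_curves N) = (if o is Some l then 2 <= l <= N else true)%N.
Proof.
apply/allpairsP/idP => [[[r o'] [_ /= ho [_ ->]]]|ho].
  move: ho; rewrite inE => /orP[/eqP->//|/mapP[l + ->]].
  by rewrite mem_index_iota.
exists (q, o); split=> //=; first by rewrite mem_enum.
case: o ho => [l|//] hl; rewrite inE /=; apply/mapP; exists l => //.
by rewrite mem_index_iota.
Qed.

Lemma short_curves_uniq (N : nat) : uniq (short_curves N).
Proof.
apply: allpairs_uniq => [||[? ?] [? ?] _ _ //]; first exact: enum_uniq.
rewrite /= map_inj_uniq ?iota_uniq => [|? ? []//].
by rewrite andbT; apply/mapP => -[].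
Qed.

Lemma noncrossing_short (N : nat) (T : {fset curve N}) :
  noncrossing_arcs T -> {subset T <= short_curves N}.
Proof.
move=> Tnc [q [l|]] qT; rewrite mem_short_curves //.
exact: noncrossing_length Tnc qT.
Qed.

Lemma lifted_edge_nocross (N : nat) (N0 : (0 < N)%N) (T : {fset curve N})
    (i j k l : int) :
  noncrossing_arcs T -> lifted_edge N0 T i j -> lifted_edge N0 T k l ->
  ~~ [&& i < k, k < j & j < l].
Proof.
move=> [_ Tnc] /andP[ij /orP[/eqP->|ijT]] /andP[kl /orP[/eqP->|klT]]; [lia..|].
apply/negP => cr; apply: (Tnc _ _ ijT klT).
apply/crossing_residue; exists 0; rewrite mul0r addr0 /=; lia.
Qed.

Lemma triangulation_lifted (N : nat) (N0 : (0 < N)%N) (T : {fset curve N}) :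
  triangulation T ->
  lifted_triangulation N (lifted_edge N0 T) (lifted_puncture_arc N0 T).
Proof.
move=> hT; have [[Tess Tnc] _] := hT; split=> //.
- move=> i j; rewrite /lifted_edge -[N%:Z]mul1r residueMD.
  rewrite (_ : (i + 1 * N < j + 1 * N) = (i < j)); last by lia.
  rewrite (_ : (j + 1 * N == i + 1 * N + 1) = (j == i + 1)); last by lia.
  by rewrite (_ : j + 1 * N - (i + 1 * N) = j - i); last by lia.
- by move=> i; rewrite /lifted_puncture_arc -[N%:Z]mul1r residueMD.
- by move=> i j /andP[].
- by move=> i; rewrite /lifted_edge eqxx; lia.
- by move=> i j k l; apply: lifted_edge_nocross; case: hT.
- move=> i j k /andP[ij /orP[/eqP->|ijT]] kT; first by lia.
  apply/negP => cr; apply: (Tnc _ _ ijT kT).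
  by apply/crossing_residue; exists 0; rewrite mul0r addr0 /=; lia.
- move=> i j ij jN ncE ncP; rewrite /lifted_edge ij /=.
  have [//|ji1 /=] := eqVneq j (i + 1).
  apply: triangulation_mem => // [||[y o] yT].
  + by rewrite /essential /=; lia.
  (* A curve of length at most [N] is not interlaced with its translates by multiples of [N]. *)
  + move=> /crossing_residue[t] /=.
    have [t0|t0] := lerP t 0; have : 0 <= (`|t|%N * N)%N%:Z by []; nia.
  + rewrite -[y](residue_ord N0) => /crossing_residue[t].
    rewrite -[y](residue_ord N0) -(residueMD N0 _ t) in yT.
    move: (_ + t * _) yT => z zT; case: o zT => [l|] zT /=; last first.
      by have := ncP z zT; lia.
    have := Tess _ zT; rewrite /essential /= => l2.
    have := ncE z (z + l%:Z); rewrite /lifted_edge.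
    rewrite [z + _]addrC addrK zT orbT andbT => /(_ ltac:(lia)); lia.
- move=> k ncE; apply: triangulation_mem => // [|[y o] yT].
    by move=> /crossing_residue[t].
  rewrite -[y](residue_ord N0) => /crossing_residue[t].
  rewrite -[y](residue_ord N0) -(residueMD N0 _ t) in yT.
  move: (_ + t * _) yT => z zT; case: o zT => [l|] zT //=.
  have := Tess _ zT; rewrite /essential /= => l2.
  have := ncE z (z + l%:Z); rewrite /lifted_edge.
  by rewrite [z + _]addrC addrK zT orbT andbT => /(_ ltac:(lia)); lia.
Qed.

Lemma lifted_edge_arc (N : nat) (N0 : (0 < N)%N) (T : {fset curve N})
    (i : int) (l : nat) : (1 < l)%N ->
  lifted_edge N0 T i (i + l%:Z) = ((residue N0 i, Some l) \in T).
Proof.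
move=> l1; have il : i < i + l%:Z by lia.
have il1 : (i + l%:Z == i + 1) = false by lia.
have ill : `|(i + l%:Z - i)%R|%N = l by lia.
by rewrite /lifted_edge il il1 ill.
Qed.

(** Each arc end at the marked point has one lift at [i]: starts become right arcs, final ends left
    arcs, and a loop counts once on each side. *)
Lemma triangulation_quiddityE (N : nat) (N0 : (0 < N)%N)
    (T : {fset curve N}) (i : int) :
  noncrossing_arcs T ->
  triangulation_quiddity T (residue N0 i) =
    (1 + right_arcs (lifted_edge N0 T) i N + left_arcs (lifted_edge N0 T) i N
       + lifted_puncture_arc N0 T i)%N.
Proof.
move=> Tnc; rewrite /triangulation_quiddity -!addnA; congr (1 + _)%N.
set p := residue N0 i.
have T_U : perm_eq T [seq c <- short_curves N | c \in T].
  apply: uniq_perm => [||c]; first exact: fset_uniq.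
    exact: filter_uniq (short_curves_uniq N).
  rewrite mem_filter; case: (boolP (c \in T)) => //= cT.
  by rewrite (noncrossing_short Tnc cT).
rewrite (perm_big _ T_U) big_filter big_mkcond big_allpairs /=.
rewrite exchange_big big_cons big_map /= addnC addnA.
congr (_ + _)%N; last first.
  rewrite big_enum (bigD1 p) //= big1 ?addn0 => [|q /negbTE qp].
    by rewrite /lifted_puncture_arc -/p /ends_at /= eqxx; case: ifP.
  by rewrite /ends_at /= qp; case: ifP.
rewrite /right_arcs /left_arcs -big_split /=.
rewrite big_nat [RHS]big_nat; apply: eq_bigr => l /andP[l2 _].
rewrite lifted_edge_arc // -/p.
have -> : lifted_edge N0 T (i - l%:Z) i =
    ((residue N0 (i - l%:Z), Some l) \in T).
  by rewrite -{2}[i](subrK l%:Z) lifted_edge_arc.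
set q := residue N0 (i - l%:Z).
rewrite big_enum /=.
transitivity (\sum_(r : 'I_N) (((r, Some l) \in T) && (r == p)) +
              \sum_(r : 'I_N) (((r, Some l) \in T) && (r == q)))%N.
  rewrite -big_split; apply: eq_bigr => r _; rewrite /ends_at /=.
  have -> : ((r + l) %% N == p)%N = (r == q).
    rewrite /p /q -[r in RHS](residue_ord N0) residue_eq.
    rewrite -(eqz_modDr l%:Z) subrK -(residue_eq N0) -val_eqE /=.
    by rewrite -PoszD modz_nat.
  by case: (_ \in T).
have sum_pred1 (r0 : 'I_N) :
    (\sum_(r : 'I_N) (((r, Some l) \in T) && (r == r0)) =
      ((r0, Some l) \in T))%N.
  rewrite (bigD1 r0) //= eqxx andbT big1 ?addn0 // => r /negbTE->.
  by rewrite andbF.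
by rewrite !sum_pred1.
Qed.

(** * Triangulation from a periodic solution *)

(** The double negation avoids deciding maximality and suffices for a contradiction. Induction on
    the room left in [short_curves]. *)
Lemma triangulation_extension (N : nat) (T : {fset curve N}) :
  noncrossing_arcs T ->
  ~ forall T', triangulation T' -> ~ (T `<=` T')%fset.
Proof.
have [k] : exists k, (size (short_curves N) < #|` T| + k)%N.
  by exists (size (short_curves N)).+1; lia.
elim: k T => [|k IH] T lek Tnc noT.
  have : (#|` T| <= size (short_curves N))%N.
    exact: uniq_leq_size (fset_uniq T) (noncrossing_short Tnc).
  by lia.
apply: (noT T) (fsubset_refl T); split=> // T' T'nc sTT'.
have [//|neqT] := eqVneq T' T; exfalso.
have ltT : (#|` T| < #|` T'|)%N.
  by apply: fproper_ltn_card; rewrite fproperEneq eq_sym neqT.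
have leT' : (#|` T'| <= size (short_curves N))%N.
  exact: uniq_leq_size (fset_uniq T') (noncrossing_short T'nc).
apply: (IH T') => // [|T'' hT'' sT'T'']; first by lia.
by apply: (noT T'' hT''); apply: fsubset_trans sT'T''.
Qed.

(* Sturm comparison: the Wronskian of [f] and [g] is monotone and periodic,
   hence constant. *)
Lemma positive_periodic_eq (a b f g : int -> int) (N i : int) :
  0 < N -> positive_periodic a f N -> positive_periodic b g N ->
  (forall i, a i <= b i) -> a i = b i.
Proof.
move=> N0 [hf fN fpos] [hg gN gpos] le_ab.
pose w k := wronskian f g k (k + 1).
have wS k : w k = w (k - 1) + f k * g k * (b k - a k).
  by rewrite /w (wronskian_step k hf hg) subrK.
have w_le k (q : nat) : w k <= w (k + q%:Z).
  elim: q => [|q IH]; first by rewrite addr0.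
  apply: le_trans IH _; rewrite (wS (k + q.+1%:Z)).
  have -> : k + q.+1%:Z - 1 = k + q%:Z by lia.
  by rewrite lerDl mulr_ge0 ?subr_ge0 // ltW // mulr_gt0.
have wN : w (i - 1 + N) = w (i - 1).
  by rewrite /w /wronskian -!(addrAC _ 1) !fN !gN.
(* Once around: [w i <= w (i - 1 + N) = w (i - 1)], so the increment at [i] is not positive. *)
have := w_le i `|N - 1|%N; have -> : i + `|N - 1|%N%:Z = i - 1 + N by lia.
rewrite wN wS gerDl pmulr_rle0 ?mulr_gt0 // subr_le0 => le_ba.
by apply/eqP; rewrite eq_le le_ab.
Qed.

Lemma positive_periodic_average (a f : int -> int) (n : int) (k : nat) :
  (0 < k)%N -> (forall i, a (i + n) = a i) ->
  positive_periodic a f (k%:Z * n) -> exists g, positive_periodic a g n.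
Proof.
case: k => // k _ an [hf fN fpos].
exists (fun i => \sum_(t < k.+1) f (i + (t : nat)%:Z * n)); split=> i.
- rewrite mulr_sumr -sumrB; apply: eq_bigr => t _.
  rewrite addrAC hf (periodicM i _ an).
  by congr (_ - f _); lia.
- rewrite big_ord_recr big_ord_recl /= addrC; congr (_ + _).
    by rewrite mul0r addr0 -(fN i); congr f; lia.
  by apply: eq_bigr => t _; congr f; rewrite /bump; lia.
- by rewrite big_ord_recl ltr_wpDr // sumr_ge0 // => t _; apply: ltW.
Qed.

(* Two vectors of determinant 1 leave no room for a lattice point of height 1
   strictly inside their cone, so [g] cannot change sign without vanishing. *)
Lemma unit_crossing (y g : nat -> int) :
  y 0%N = 0 -> (forall k, 0 < y k.+1) ->
  (forall k, y k * g k.+1 - y k.+1 * g k = 1) ->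
  g 1%N < 0 -> (exists k, 0 <= g k.+1) ->
  exists k, [/\ (2 <= k)%N, y k = 1 & g k = 0].
Proof.
move=> y0 ypos det g1 exg.
have [k gk kmin] := ex_minnP exg.
case: k gk kmin => [|k] gk kmin; first by lia.
have gk1 : g k.+1 < 0.
  by rewrite ltNge; apply/negP => /kmin; lia.
(* The term [- y2 * g1'] is at least 1 and so exhausts the determinant, leaving [y1 * g2 = 0]. *)
have cone (y1 y2 g1' g2 : int) : 0 < y1 -> 0 < y2 -> g1' < 0 -> 0 <= g2 ->
    y1 * g2 - y2 * g1' = 1 -> y2 = 1 /\ g2 = 0.
  by move=> *; have g2_0 : g2 = 0; [nia|subst g2; split=> //; nia].
have [y1 g0] := cone _ _ _ _ (ypos k) (ypos k.+1) gk1 gk (det k.+1).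
by exists k.+2.
Qed.

(** * Arcs from unit determinants *)

Section Fan.

Variables (a X Y f : int -> int) (N : nat).
Hypothesis N0 : (0 < N)%N.
Hypothesis hXY : frieze_vectors a X Y.
Hypothesis aN : forall i, a (i + N%:Z) = a i.
Hypothesis hf : positive_periodic a f N%:Z.

Local Notation D := (wronskian X Y).

(** Periodicity of [f] makes these determinants additive over blocks of length [N], each adding at
    least 1. *)
Lemma wronskian_growth (p : int) (q : nat) : q%:Z <= D p (p + q%:Z * N%:Z).
Proof.
have [hs fN fpos] := hf; have Dpos := fv_gt0 hXY.
elim: q => [|q IH]; first by rewrite mul0r addr0 /wronskian subrr.
have := solution_three_terms p (p + q.+1%:Z * N%:Z) (p + q%:Z * N%:Z) hXY hs.
rewrite !(periodicM _ _ fN) -mulrDr => /(mulfI (lt0r_neq0 (fpos p))) ->.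
have : 0 < D (p + q%:Z * N%:Z) (p + q.+1%:Z * N%:Z) by apply: Dpos; lia.
lia.
Qed.

(** Supplies the sign change for [unit_crossing]: [fp] and [c] are adjacent values of [f], and the
    last equation is a three-term relation over several periods. *)
Lemma unit_bound (fp c t y1 y2 : int) :
  0 < fp -> t * fp < c -> fp <= y2 -> c * y2 = fp * y1 + fp ->
  0 <= y1 - t * y2.
Proof.
move=> fp0 tc le_y three; rewrite -(pmulr_rge0 _ fp0).
have le_c : 1 * y2 <= (c - t * fp) * y2 by apply: ler_wpM2r; lia.
have -> : fp * (y1 - t * y2) = (fp * y1 + fp) - fp - t * fp * y2 by ring.
by move: le_c; rewrite mulrBl three; lia.
Qed.

(** [g k] is the determinant of [u_(p+1) - t u_p] and [u_(p+k)]: it is [- t] at 1 and nonnegative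
    far out, as [t < f (p + 1) / f p]. The value [t] distinguishes the arcs found. *)
Lemma right_unit (p : int) (t : nat) : (0 < t)%N -> t%:Z * f p < f (p + 1) ->
  exists l : nat,
    [/\ (2 <= l)%N, D p (p + l%:Z) = 1 & D (p + 1) (p + l%:Z) = t%:Z].
Proof.
move=> t0 tf; have [hs fN fpos] := hf; have Dpos := fv_gt0 hXY.
pose y (k : nat) := D p (p + k%:Z).
pose g (k : nat) := D (p + 1) (p + k%:Z) - t%:Z * y k.
have [||k|||l [l2 yl gl]] := @unit_crossing y g.
- by rewrite /y addr0 /wronskian subrr.
- by move=> k; apply: Dpos; lia.
- transitivity (D p (p + 1) * D (p + k%:Z) (p + k%:Z + 1)).
    by rewrite /g /y (_ : p + k.+1%:Z = p + k%:Z + 1) /wronskian; [ring|lia].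
  by rewrite !(wronskian1 _ hXY).
- by rewrite /g /y (wronskian1 _ hXY) [D _ _]subrr; lia.
- have q0 : (0 < `|f p| * N)%N by have := fpos p; lia.
  have qE : (`|f p| * N)%N%:Z = `|f p|%N%:Z * N%:Z by [].
  (* After [f p] periods the determinant with [u_p] is at least [f p], as [unit_bound] asks. *)
  exists (`|f p| * N)%N.-1; rewrite prednK //.
  apply: unit_bound (fpos p) tf _ _.
    by rewrite /y qE; have := wronskian_growth p `|f p|; have := fpos p; lia.
  rewrite /y qE (solution_three_terms _ _ _ hXY hs) (periodicM _ _ fN).
  by rewrite (wronskian1 _ hXY) mulr1.
- by exists l; split=> //; move: gl; rewrite /g yl; lia.
Qed.

Lemma left_unit (p : int) (t : nat) : (0 < t)%N -> t%:Z * f p < f (p - 1) ->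
  exists l : nat,
    [/\ (2 <= l)%N, D (p - l%:Z) p = 1 & D (p - l%:Z) (p - 1) = t%:Z].
Proof.
move=> t0 tf; have [hs fN fpos] := hf; have Dpos := fv_gt0 hXY.
pose y (k : nat) := D (p - k%:Z) p.
pose g (k : nat) := D (p - k%:Z) (p - 1) - t%:Z * y k.
have D1 : D (p - 1) p = 1 by have := wronskian1 (p - 1) hXY; rewrite subrK.
have [||k|||l [l2 yl gl]] := @unit_crossing y g.
- by rewrite /y subr0 /wronskian subrr.
- by move=> k; apply: Dpos; lia.
- transitivity (D (p - 1) p * D (p - k.+1%:Z) (p - k.+1%:Z + 1)).
    by rewrite /g /y (_ : p - k%:Z = p - k.+1%:Z + 1) /wronskian; [ring|lia].
  by rewrite D1 (wronskian1 _ hXY).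
- by rewrite /g /y D1 [D _ _]subrr; lia.
- have q0 : (0 < `|f p| * N)%N by have := fpos p; lia.
  have qE : (`|f p| * N)%N%:Z = `|f p|%N%:Z * N%:Z by [].
  exists (`|f p| * N)%N.-1; rewrite prednK //.
  apply: unit_bound (fpos p) tf _ _.
    rewrite /y qE; have := wronskian_growth (p - `|f p|%N%:Z * N%:Z) `|f p|.
    by rewrite subrK; have := fpos p; lia.
  rewrite /y qE (solution_three_terms _ _ _ hXY hs) -mulNr (periodicM _ _ fN).
  by rewrite D1 mulr1 addrC.
- by exists l; split=> //; move: gl; rewrite /g yl; lia.
Qed.

(** If [N < l], Ptolemy for the curve and its translate by [N] writes 1 as a sum of two positive
    products. *)
Lemma unit_length (i : int) (l : nat) : D i (i + l%:Z) = 1 -> (l <= N)%N.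
Proof.
move=> D1; rewrite leqNgt; apply/negP => ltNl; have Dpos := fv_gt0 hXY.
have := ptolemy X Y i (i + N%:Z) (i + l%:Z) (i + l%:Z + N%:Z).
rewrite /= (wronskian_shift i _ hXY aN) D1 mulr1.
have [] : [/\ 0 < D i (i + N%:Z), 0 < D (i + l%:Z) (i + l%:Z + N%:Z),
    0 < D i (i + l%:Z + N%:Z) & 0 < D (i + N%:Z) (i + l%:Z)].
  by split; apply: Dpos; lia.
move: (D _ _) (D _ _) (D _ _) (D _ _) => d1 d2 d3 d4; nia.
Qed.

Lemma count_lower_bound (F : nat -> bool) (val : nat -> nat) (K : nat) :
  (forall t, (0 < t <= K)%N ->
     exists l, [/\ (2 <= l <= N)%N, F l & val l = t]) ->
  (K <= \sum_(2 <= l < N.+1) F l)%N.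
Proof.
move=> hits.
have -> : (\sum_(2 <= l < N.+1) F l)%N = size (filter F (index_iota 2 N.+1)).
  rewrite -sum1_size big_filter [RHS]big_mkcond.
  by apply: eq_bigr => l _; case: (F l).
rewrite -(size_map val) -[K](size_iota 1).
apply: uniq_leq_size (iota_uniq _ _) _.
move=> t; rewrite mem_iota => ht; have [l [l_N Fl <-]] := hits t ltac:(lia).
by apply: map_f; rewrite mem_filter Fl mem_index_iota.
Qed.

Definition unit_curves : {fset curve N} :=
  [fset c in short_curves N |
     let x : int := (c.1 : nat)%:Z in
     if c.2 is Some l then D x (x + l%:Z) == 1 else f x == 1]%fset.

Lemma unit_arc_mem (i : int) (l : nat) :
  (2 <= l)%N -> D i (i + l%:Z) = 1 -> (residue N0 i, Some l) \in unit_curves.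
Proof.
move=> l2 D1; rewrite !inE mem_short_curves l2 (unit_length D1) /=.
have [t it] := residue_lift N0 i.
have tN : forall i, a (i + t * N%:Z) = a i by move=> k; apply: periodicM.
by rewrite -(wronskian_shift _ _ hXY tN) addrAC -it D1.
Qed.

Lemma unit_puncture_mem (i : int) :
  f i = 1 -> (residue N0 i, None) \in unit_curves.
Proof.
move=> f1; rewrite !inE mem_short_curves /=.
have [t it] := residue_lift N0 i; have fN := pp_periodic hf.
by rewrite -(periodicM _ t fN) -it f1.
Qed.

(** A crossing would write 1 as a sum of two positive products, by Ptolemy for two arcs and by the
    three-term relation for an arc and a puncture arc. *)
Lemma unit_noncrossing : noncrossing_arcs unit_curves.
Proof.
have [hs fN fpos] := hf; have Dpos := fv_gt0 hXY.
have shift (t i j : int) : D (i + t * N%:Z) (j + t * N%:Z) = D i j.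
  by apply: wronskian_shift hXY _ => k; apply: periodicM.
have nc (x y : int) (l l' : nat) : D x (x + l%:Z) = 1 -> D y (y + l'%:Z) = 1 ->
    ~~ [&& x < y, y < x + l%:Z & x + l%:Z < y + l'%:Z].
  move=> Dx Dy; apply/negP => /and3P[h1 h2 h3].
  have := ptolemy X Y x y (x + l%:Z) (y + l'%:Z); rewrite /= Dx Dy mulr1.
  have := Dpos _ _ h1; have := Dpos _ _ h2; have := Dpos _ _ h3.
  have := Dpos x (y + l'%:Z) ltac:(lia).
  by move: (D _ _) (D _ _) (D _ _) (D _ _) => d1 d2 d3 d4; nia.
have ncP (x y : int) (l : nat) : D x (x + l%:Z) = 1 -> f y = 1 ->
    ~~ (x < y < x + l%:Z).
  move=> Dx fy; apply/negP => /andP[h1 h2].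
  have := solution_three_terms x (x + l%:Z) y hXY hs; rewrite Dx fy mulr1.
  have := Dpos _ _ h1; have := Dpos _ _ h2.
  have := fpos x; have := fpos (x + l%:Z).
  by move: (D _ _) (D _ _) (f _) (f _) => d1 d2 d3 d4; nia.
split=> [[p [l|]]|[p o] [q o'] + + /crossingE[t]].
- by rewrite !inE mem_short_curves => /andP[/andP[]].
- by [].
rewrite !inE /= => /andP[_ hp] /andP[_ hq].
case: o o' hp hq => [l|] [l'|] //= /eqP hp /eqP hq.
- rewrite -(shift t) addrAC in hq.
  by move=> /orP[];
    [apply/negP: (nc _ _ _ _ hp hq)|apply/negP: (nc _ _ _ _ hq hp)].
- by rewrite -(periodicM _ t fN) in hq; apply/negP: (ncP _ _ _ hp hq).
- by rewrite -(shift t) addrAC in hq; apply/negP: (ncP _ _ _ hq hp).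
Qed.

Hypothesis f_primitive : forall i, (f i %| f (i + 1))%Z -> f i = 1.

Lemma unit_curves_ends (T : {fset curve N}) (i : int) :
  (unit_curves `<=` T)%fset -> noncrossing_arcs T ->
  a i <= (triangulation_quiddity T (residue N0 i))%:Z.
Proof.
move=> /fsubsetP sUT Tnc; rewrite (triangulation_quiddityE N0) //.
have [hs fN fpos] := hf; have Dpos := fv_gt0 hXY.
(* The number of [t >= 1] with [t * f i < f j], the range of [right_unit] and [left_unit]. *)
pose K (j : int) := `|((f j - 1) %/ f i)%Z|%N.
have KE j : [/\ (K j)%:Z * f i < f j, f j <= (K j).+1%:Z * f i
    & ~~ (f i %| f j)%Z -> f j < (K j).+1%:Z * f i].
  have := divz_eq (f j - 1) (f i); have := ltz_pmod (f j - 1) (fpos i).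
  have := modz_ge0 (f j - 1) (lt0r_neq0 (fpos i)).
  have q0 : (0 <= (f j - 1) %/ f i)%Z.
    by rewrite divz_ge0 //; have := fpos j; lia.
  rewrite intS mulrDl mul1r /K gez0_abs //.
  move: q0 ((_ %% _)%Z) => q0 r r0 r_lt fj.
  have {}fj : f j = ((f j - 1) %/ f i)%Z * f i + r + 1 by rewrite -fj subrK.
  split=> [||ndvd]; [lia..|rewrite lt_neqAle; apply/andP; split; last by lia].
  apply: contra ndvd => /eqP ->; rewrite -{1}[f i]mul1r -mulrDl.
  exact: dvdz_mull.
have [Kr1 Kr2 Kr3] := KE (i + 1); have [Kl1 Kl2 Kl3] := KE (i - 1).
have right_le : (K (i + 1)%R <= right_arcs (lifted_edge N0 T) i N)%N.
  apply: (count_lower_bound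
    (val := fun l => `|(D (i + 1) (i + l%:Z))%R|%N)) => t ht.
  have [|l [l2 D1 Dt]] := right_unit (p := i) (t := t) ltac:(lia).
    by apply: le_lt_trans Kr1; rewrite ler_pM2r //; lia.
  exists l; split; last by rewrite Dt.
    by rewrite l2 (unit_length D1).
  by rewrite lifted_edge_arc // sUT ?unit_arc_mem.
have left_le : (K (i - 1)%R <= left_arcs (lifted_edge N0 T) i N)%N.
  apply: (count_lower_bound
    (val := fun l => `|(D (i - l%:Z) (i - 1))%R|%N)) => t ht.
  have [|l [l2 D1 Dt]] := left_unit (p := i) (t := t) ltac:(lia).
    by apply: le_lt_trans Kl1; rewrite ler_pM2r //; lia.
  have {}D1 : D (i - l%:Z) (i - l%:Z + l%:Z) = 1 by rewrite subrK.
  exists l; split; last by rewrite Dt.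
    by rewrite l2 (unit_length D1).
  rewrite -[X in lifted_edge _ _ _ X](subrK l%:Z) lifted_edge_arc //.
  by rewrite sUT ?unit_arc_mem.
have af : a i * f i = f (i + 1) + f (i - 1) by rewrite hs subrK.
(* If [f i = 1], the puncture arc supplies the last end; otherwise primitivity makes a bound strict,
   which gains the same unit. *)
have [f1|f1] := eqVneq (f i) 1.
  have Pi : lifted_puncture_arc N0 T i by apply: sUT; apply: unit_puncture_mem.
  rewrite Pi f1 in af Kr2 Kl2 *; lia.
have nd : ~~ (f i %| f (i + 1))%Z by apply: contra f1 => /f_primitive->.
have : a i * f i < ((K (i + 1)).+1%:Z + (K (i - 1)).+1%:Z) * f i.
  by rewrite af mulrDl ltr_leD // Kr3.
rewrite ltr_pM2r //; lia.
Qed.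

End Fan.

(** * Growth coefficients as traces, and the equivalence *)

Lemma growth_coefficient_trace (m : int -> int -> int) (X Y : int -> int)
    (n k : nat) :
  (forall i j, i <= j -> m (i + 1) (j - 1) = wronskian X Y i j) ->
  (0 < n)%N -> (0 < k)%N ->
  growth_coefficient m n k = trace X Y (k%:Z * n%:Z).
Proof.
move=> mE n0 k0; have kn0 : (0 < k * n)%N by rewrite muln_gt0 k0.
rewrite /growth_coefficient gtn_eqF // /trace -PoszM -!mE; [|lia..].
by rewrite add0r addrK.
Qed.

Lemma punctured_disc_periodic (a : int -> int) (k : int) (N : nat)
    (N0 : (0 < N)%N) (T : {fset curve N}) :
  triangulation T ->
  (forall i, a (k + i) = (triangulation_quiddity T (residue N0 i))%:Z) ->
  exists f, positive_periodic a f N%:Z.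
Proof.
move=> hT aE; have [Tnc _] := hT.
have [i|f [hf fN fpos]] := lifted_triangulation_periodic
    (a := fun i => a (k + i)) (triangulation_lifted N0 hT).
  by rewrite aE triangulation_quiddityE.
exists (fun i => f (i - k)); split=> // i; last by rewrite -(fN (i - k)) addrAC.
by rewrite addrAC hf addrCA subrr addr0 [in f (i - 1 - k)]addrAC.
Qed.

Lemma nth_triangulation_quiddity (N : nat) (N0 : (0 < N)%N)
    (T : {fset curve N}) (i : int) :
  let s := [seq (triangulation_quiddity T p)%:Z | p <- enum 'I_N] in
  s`_(`|(i %% (size s)%:Z)%Z|%N) = (triangulation_quiddity T (residue N0 i))%:Z.
Proof.
rewrite /= size_map size_enum_ord (nth_map (residue N0 i)).
  by rewrite -[X in nth _ _ X]/(residue N0 i : nat) nth_ord_enum.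
by rewrite size_enum_ord residue_subproof.
Qed.

Theorem corollary4p5 (m : int -> int -> int) (n : nat)
    (hm : infinite_frieze m) (hn : minimal_period m n) :
  [<-> exists k : nat, (0 < k)%N /\ 2 < growth_coefficient m n k;
       forall k : nat, (0 < k)%N -> 2 < growth_coefficient m n k;
       ~ arises_from_punctured_disc m].
Proof.
have [X [Y [hXY mE]]] := frieze_vectors_exists hm.
have [[n0 mn] _] := hn.
have an i : quiddity m (i + n%:Z) = quiddity m i by apply: mn; lia.
have akn (k : nat) i : quiddity m (i + k%:Z * n%:Z) = quiddity m i.
  exact: periodicM.
have kn0 k : (0 < k)%N -> 0 < k%:Z * n%:Z by move=> k0; rewrite mulr_gt0.
have growthE := growth_coefficient_trace mE n0.
tfae.
(* If some [s_k <= 2], the averaged [n]-periodic solution is also [k0 * n]-periodic and forces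
   [s_k0 = 2]. *)
- move=> [k0 [k0_gt0 s_k0]] k k_gt0; rewrite ltNge; apply/negP => s_k.
  rewrite growthE // in s_k.
  have [f hf] := positive_periodic_exists hXY (kn0 k k_gt0) (akn k) s_k.
  have [g [hg gn gpos]] := positive_periodic_average k_gt0 an hf.
  move: s_k0; rewrite growthE // (periodic_trace hXY (f := g)) //.
  by split=> // i; apply: periodicM.
- move=> s_gt2 [N [T [N0 hT [_ [k qE]]]]].
  have aE i : quiddity m (k + i) = (triangulation_quiddity T (residue N0 i))%:Z.
    by rewrite qE nth_triangulation_quiddity.
  have [f [hf fN fpos]] := punctured_disc_periodic hT aE.
  (* The index [N] is chosen because [N * n] is a common multiple of the period [N] of [f] and of
     [n]. *)
  have := s_gt2 N N0; rewrite growthE // (periodic_trace hXY (f := f)) //.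
  by split=> // i; rewrite mulrC; apply: periodicM.
- move=> not_disc; exists 1%N; split=> //; rewrite growthE // mul1r ltNge.
  apply/negP => s_le2; have nZ0 : 0 < n%:Z by lia.
  have [f hf f_primitive] := primitive_periodic_exists hXY nZ0 an s_le2.
  have unit_nc := unit_noncrossing n0 hXY an hf.
  apply: (triangulation_extension unit_nc) => T hT sub; apply: not_disc.
  have [Tnc _] := hT; exists n, T; split=> //; split.
    by rewrite size_map size_enum_ord.
  exists 0 => i; rewrite nth_triangulation_quiddity add0r.
  pose b i := (triangulation_quiddity T (residue n0 i))%:Z.
  have [g hg] : exists g, positive_periodic b g n%:Z.
    by apply: (punctured_disc_periodic (k := 0) hT) => j; rewrite add0r.
  apply: (positive_periodic_eq i _ hf hg) => // j.
  exact: unit_curves_ends hXY an hf f_primitive _ _ sub Tnc.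
Qed.
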